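(* Consider the system of ordinary differential equations for real functions $h_1,h_2,h_3$ of $t$ $$\dot h_1=-h_3h_2,\qquad \dot h_2=h_3h_1,\qquad \dot h_3=0 .$$ In the generic case $h_3\neq0$, the system has the solution $$h_1=C_2\sin(C_1t)+C_3\cos(C_1t),\qquad h_2=C_3\sin(C_1t)-C_2\cos(C_1t),\qquad h_3=C_1$$ for constants $C_1,C_2,C_3$ (that is, this is the general solution with $h_3=C_1\ne 0$). In the case $h_3=0$, the solution is $h_1=C_1$ and $h_2=C_2$ for constants $C_1,C_2$.
   Context: All constants are real. *)

(* Defs.v *)
From Stdlib Require Import Reals.
From Coquelicot Require Import Coquelicot.
Open Scope R_scope.

(* [a] and [b] may be infinite, so the real line is one of these intervals. *)
Definition in_interval (a b : Rbar) (t : R) : Prop :=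
  Rbar_lt a t /\ Rbar_lt t b.

Definition solves_system (a b : Rbar) (h1 h2 h3 : R -> R) : Prop :=
  forall t : R, in_interval a b t ->
    is_derive h1 t (- h3 t * h2 t) /\
    is_derive h2 t (h3 t * h1 t) /\
    is_derive h3 t 0.

(* Main.v *)
Require Import Defs.
From Stdlib Require Import Reals Lra.
From Coquelicot Require Import Coquelicot.
Open Scope R_scope.

(** On an interval, [h3] has zero derivative and is therefore a constant [c].
    The system is then the linear equation z' = i c z for z = h1 + i h2, so
    that e^(-i c t) z is a first integral.  Its real and imaginary parts,
      h1 cos (c t) + h2 sin (c t)  and  h2 cos (c t) - h1 sin (c t),
    have zero derivative, hence are constants [C3] and [- C2]; rotating back
    by the angle [c t] gives the stated formulas ([solves_system_iff]).  This
    covers every real [c]: the generic family is [c <> 0], and at [c = 0] the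
    formulas degenerate to the constants [h1 = C3], [h2 = - C2]. *)

Lemma in_interval_nonempty (a b : Rbar) :
  Rbar_lt a b -> exists t : R, in_interval a b t.
Proof.
unfold in_interval.
destruct a as [x| |], b as [y| |]; simpl; intros hab; try easy.
- exists ((x + y) / 2); lra.
- exists (x + 1); lra.
- exists (y - 1); lra.
- exists 0; easy.
Qed.

Lemma in_interval_convex (a b : Rbar) (s t x : R) :
  in_interval a b s -> in_interval a b t ->
  Rmin s t <= x <= Rmax s t -> in_interval a b x.
Proof.
intros [has hsb] [hat htb] [hmin hmax]; split.
- apply Rbar_lt_le_trans with (Rmin s t); [|exact hmin].
  now apply Rmin_case.
- apply Rbar_le_lt_trans with (Rmax s t); [exact hmax|].
  now apply Rmax_case.
Qed.

Lemma in_interval_locally (a b : Rbar) (t : R) :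
  in_interval a b t -> locally t (in_interval a b).
Proof.
apply (open_and _ _ (open_Rbar_gt a) (open_Rbar_lt b)).
Qed.

Lemma zero_derivative_constant (a b : Rbar) (f : R -> R) :
  (forall t : R, in_interval a b t -> is_derive f t 0) ->
  forall s t : R, in_interval a b s -> in_interval a b t -> f t = f s.
Proof.
intros hf s t hs ht.
destruct (MVT_gen f s t (fun _ => 0)) as [x [_ hx]].
- intros x hx; apply hf, (in_interval_convex a b s t); trivial; lra.
- intros x hx; apply continuity_pt_filterlim, (ex_derive_continuous f).
  exists 0; apply hf, (in_interval_convex a b s t); trivial.
- lra.
Qed.

(** Here [h1 sin - h2 cos] and [h1 cos + h2 sin] are, up to sign, the
    imaginary and real parts of e^(-i c t) (h1 + i h2). *)
Lemma rotated_solution_derive (h1 h2 : R -> R) (c t : R) :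
  is_derive h1 t (- c * h2 t) -> is_derive h2 t (c * h1 t) ->
  is_derive (fun x => h1 x * sin (c * x) - h2 x * cos (c * x)) t 0 /\
  is_derive (fun x => h1 x * cos (c * x) + h2 x * sin (c * x)) t 0.
Proof.
intros d1 d2; pose proof (is_derive_unique _ _ _ d1) as e1.
pose proof (is_derive_unique _ _ _ d2) as e2.
split; (auto_derive; [repeat split; eexists; eassumption|]);
  rewrite ?(Derive_ext (fun x => h1 x) h1), ?(Derive_ext (fun x => h2 x) h2)
    by trivial; rewrite e1, e2; ring.
Qed.

(** The two cases [h3 <> 0] and [h3 = 0] are the members [C1 <> 0] and
    [C1 = 0] of this single family. *)
Lemma solves_system_iff (a b : Rbar) (h1 h2 h3 : R -> R) :
  Rbar_lt a b ->
  solves_system a b h1 h2 h3 <->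
  exists C1 C2 C3 : R, forall t : R, in_interval a b t ->
    h1 t = C2 * sin (C1 * t) + C3 * cos (C1 * t) /\
    h2 t = C3 * sin (C1 * t) - C2 * cos (C1 * t) /\
    h3 t = C1.
Proof.
intros hab; split.
- intros hsol; destruct (in_interval_nonempty a b hab) as [t0 ht0].
  pose (c := h3 t0).
  pose (u := fun x => h1 x * sin (c * x) - h2 x * cos (c * x)).
  pose (v := fun x => h1 x * cos (c * x) + h2 x * sin (c * x)).
  assert (h3c : forall t, in_interval a b t -> h3 t = c).
  { intros t ht; apply (zero_derivative_constant a b); trivial.
    intros x hx; apply (hsol x hx). }
  assert (duv : forall t, in_interval a b t ->
                  is_derive u t 0 /\ is_derive v t 0).
  { intros t ht; destruct (hsol t ht) as [d1 [d2 _]].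
    rewrite (h3c t ht) in d1, d2.
    now apply rotated_solution_derive. }
  exists c, (u t0), (v t0); intros t ht.
  rewrite <- (zero_derivative_constant a b u (fun x hx => proj1 (duv x hx))
                t0 t ht0 ht).
  rewrite <- (zero_derivative_constant a b v (fun x hx => proj2 (duv x hx))
                t0 t ht0 ht).
  pose proof (sin2_cos2 (c * t)) as one; unfold Rsqr in one.
  unfold u, v; repeat split; [| |now apply h3c].
  + transitivity (h1 t * (sin (c * t) * sin (c * t) + cos (c * t) * cos (c * t)));
      [rewrite one|]; ring.
  + transitivity (h2 t * (sin (c * t) * sin (c * t) + cos (c * t) * cos (c * t)));
      [rewrite one|]; ring.
- intros [c [C2 [C3 hform]]] t ht.
  destruct (hform t ht) as [e1 [e2 e3]]; rewrite e1, e2, e3.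
  (* The formulas hold only on the interval, but it is a neighbourhood of t. *)
  pose proof (in_interval_locally a b t ht) as hloc.
  split; [|split].
  + apply (is_derive_ext_loc (fun x => C2 * sin (c * x) + C3 * cos (c * x))).
    * revert hloc; apply filter_imp; intros x hx; symmetry; apply (hform x hx).
    * auto_derive; [trivial|ring].
  + apply (is_derive_ext_loc (fun x => C3 * sin (c * x) - C2 * cos (c * x))).
    * revert hloc; apply filter_imp; intros x hx; symmetry; apply (hform x hx).
    * auto_derive; [trivial|ring].
  + apply (is_derive_ext_loc (fun _ => c)).
    * revert hloc; apply filter_imp; intros x hx; symmetry; apply (hform x hx).
    * auto_derive; [trivial|ring].
Qed.

Theorem proposition3p7 (a b : Rbar) (hab : Rbar_lt a b) (h1 h2 h3 : R -> R) :
  ((solves_system a b h1 h2 h3 /\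
      ~ (forall t : R, in_interval a b t -> h3 t = 0)) <->
   (exists C1 C2 C3 : R, C1 <> 0 /\
      forall t : R, in_interval a b t ->
        h1 t = C2 * sin (C1 * t) + C3 * cos (C1 * t) /\
        h2 t = C3 * sin (C1 * t) - C2 * cos (C1 * t) /\
        h3 t = C1)) /\
  ((solves_system a b h1 h2 h3 /\
      (forall t : R, in_interval a b t -> h3 t = 0)) <->
   (exists C1 C2 : R,
      forall t : R, in_interval a b t ->
        h1 t = C1 /\ h2 t = C2 /\ h3 t = 0)).
Proof.
rewrite (solves_system_iff a b h1 h2 h3 hab).
destruct (in_interval_nonempty a b hab) as [t0 ht0].
split; split.
- intros [[C1 [C2 [C3 hform]]] hnz]; exists C1, C2, C3; split; trivial.
  intros hC1; apply hnz; intros t ht; rewrite <- hC1; apply (hform t ht).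
- intros [C1 [C2 [C3 [hC1 hform]]]]; split; [now exists C1, C2, C3|].
  intros hz; apply hC1; rewrite <- (hz t0 ht0); symmetry; apply (hform t0 ht0).
- intros [[C1 [C2 [C3 hform]]] hz].
  assert (hC1 : C1 = 0).
  { rewrite <- (hz t0 ht0); symmetry; apply (hform t0 ht0). }
  exists C3, (- C2); intros t ht; destruct (hform t ht) as [e1 [e2 e3]].
  rewrite e1, e2, e3, hC1, Rmult_0_l, sin_0, cos_0; repeat split; ring.
- intros [C1 [C2 hconst]]; split; [|intros t ht; apply (hconst t ht)].
  exists 0, (- C2), C1; intros t ht; destruct (hconst t ht) as [e1 [e2 e3]].
  rewrite e1, e2, e3, Rmult_0_l, sin_0, cos_0; repeat split; ring.
Qed.
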